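(* Consider the team $(\mathcal{P}_\infty)$ with cost function $c$ convex in its second and third arguments $\mathbb{P}$-almost surely. Let the action space of each decision maker be compact and convex, and let $v^i=h(x,z^i)$ for $i\in\mathbb{N}$, where the $z^i$ are i.i.d. random variables. Suppose there exists a sequence $\{\gamma_N^*\}_N$ of (identically symmetric) optimal policies for $(\mathcal{P}_N)$, i.e. for each $N$ the policy in which all $N$ decision makers use $\gamma_N^*$ is optimal for $(\mathcal{P}_N)$, which converges pointwise to $\gamma_\infty^*$ as $N\to\infty$. Then $\gamma_\infty^*$ (which is identically symmetric, i.e. every decision maker uses $\gamma_\infty^*$) is an optimal policy for $(\mathcal{P}_\infty)$.
   Context: Setting. All random variables live on a probability space $(\Omega,\mathcal{F},\mathbb{P})$; $n,m$ are positive integers. For each $i\in\mathbb{N}$, decision maker $i$ (DM$^i$) observes an $\mathbb{R}^m$-valued random variable $v^i$, which is not affected by the action of any decision maker (the team is static), and applies the action $u^i=\gamma^i(v^i)$ in the action space $\mathbb{U}$, the same for all DMs (nominally $\mathbb{R}^n$, more generally a subset of $\mathbb{R}^n$ with the stated properties). In the representation $v^i=h(x,z^i)$, $x$ is a random variable common to all decision makers and $h$ is a measurable function. $\Gamma^i$ is the set of admissible policies of DM$^i$, i.e. measurable functions $\gamma^i:\mathbb{R}^m\to\mathbb{U}$; $\mathbf{\Gamma}_N=\prod_{i=1}^N\Gamma^i$ and $\mathbf{\Gamma}=\prod_{i\in\mathbb{N}}\Gamma^i$. $\omega_0$ is an exogenous $\Omega_0$-valued random variable and $c:\Omega_0\times\mathbb{R}^n\times\mathbb{R}^n\to\mathbb{R}_+$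 is a Borel measurable cost function. Problem $(\mathcal{P}_N)$: for $\underline\gamma_N=(\gamma^1,\dots,\gamma^N)\in\mathbf{\Gamma}_N$, $J_N(\underline\gamma_N)=\frac1N\mathbb{E}^{\underline\gamma_N}\big[\sum_{i=1}^N c(\omega_0,u^i,\frac1N\sum_{p=1}^N u^p)\big]$; optimal means attaining $\inf_{\mathbf{\Gamma}_N}J_N$. Problem $(\mathcal{P}_\infty)$: for $\underline\gamma=(\gamma^1,\gamma^2,\dots)\in\mathbf{\Gamma}$, $J(\underline\gamma)=\limsup_{N\to\infty}\frac1N\mathbb{E}^{\underline\gamma}\big[\sum_{i=1}^N c(\omega_0,u^i,\frac1N\sum_{p=1}^N u^p)\big]$; optimal means attaining $\inf_{\mathbf{\Gamma}}J$. Here $\mathbb{E}^{\underline\gamma}[\cdot]$ means that $u^i=\gamma^i(v^i)$ is substituted for all $i$.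
   Formalization: Two assumptions are added, as the claim fails without either: the common variable x is independent of the sequence (z^i), and c(ω_0,u,a), for u and a in the action space, is almost surely bounded by an integrable random variable. *)

(* Defs.v *)
From HB Require Import structures.
From mathcomp Require Import all_boot all_order all_algebra.
From mathcomp Require Import all_classical all_reals all_analysis.

Set Implicit Arguments.
Unset Strict Implicit.
Unset Printing Implicit Defensive.

Import Order.TTheory GRing.Theory Num.Theory.
Import numFieldNormedType.Exports.

Local Open Scope classical_set_scope.
Local Open Scope ring_scope.

(* 'rV[R]_k carries no measurable structure in the library. *)
Notation borel R k := (g_sigma_algebraType (@open 'rV[R]_k)).

Section independence.
Context (d : measure_display) (T : measurableType d) (R : realType).
Context (P : probability T R).

Definition sigma_of (d' : measure_display) (S : measurableType d')
    (X : T -> S) : set (set T) :=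
  preimage_set_system setT X measurable.

Definition sigma_of_seq (d' : measure_display) (S : measurableType d')
    (Z : nat -> T -> S) : set (set T) :=
  <<s \bigcup_i sigma_of (Z i) >>.

Definition independent_sigma (F G : set (set T)) : Prop :=
  forall A B, F A -> G B -> P (A `&` B) = (P A * P B)%E.

Definition mutually_independent (d' : measure_display) (S : measurableType d')
    (Z : nat -> T -> S) : Prop :=
  forall (s : seq nat) (A : nat -> set T), uniq s ->
    (forall i, i \in s -> sigma_of (Z i) (A i)) ->
    P (\bigcap_(i in [set` s]) A i) = (\prod_(i <- s) P (A i))%E.

Definition identically_distributed (d' : measure_display)
    (S : measurableType d') (Z : nat -> T -> S) : Prop :=
  forall (i j : nat) (A : set S), measurable A ->
    P (Z i @^-1` A) = P (Z j @^-1` A).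

Definition iid (d' : measure_display) (S : measurableType d')
    (Z : nat -> T -> S) : Prop :=
  mutually_independent Z /\ identically_distributed Z.

End independence.

Definition minimizes (R : realType) (X : Type) (D : set X) (J : X -> \bar R)
    (g : X) : Prop :=
  D g /\ J g = ereal_inf (J @` D).

Section team.
Context (R : realType) (n m : nat).

Definition policy : Type := 'rV[R]_m -> 'rV[R]_n.

(* Measurability into U, with the trace of the Borel sets, amounts to
   measurability into R^n with values in U. *)
Definition admissible (U : set 'rV[R]_n) : set policy :=
  [set g : policy | measurable_fun [set: borel R m] (g : borel R m -> borel R n)
                    /\ forall y, U (g y)].

Context (d d0 : measure_display) (T : measurableType d)
  (P : probability T R) (Omega0 : measurableType d0).
Context (c : Omega0 -> 'rV[R]_n -> 'rV[R]_n -> R) (omega0 : T -> Omega0).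
Context (v : nat -> T -> 'rV[R]_m).

(* Decision makers are numbered from 0. *)
Definition team_cost (N : nat) (g : 'I_N -> policy) : \bar R :=
  ((N%:R^-1)%:E *
   'E_P[fun w => (\sum_(i < N)
          c (omega0 w) (g i (v i w))
            (N%:R^-1 *: \sum_(p < N) g p (v p w)))%R])%E.

Definition optimal_team (U : set 'rV[R]_n) (N : nat) (g : 'I_N -> policy) :
    Prop :=
  minimizes [set g' : 'I_N -> policy | forall i, admissible U (g' i)]
    (@team_cost N) g.

(* The degenerate term N = 0 does not affect the limsup. *)
Definition team_cost_infty (g : nat -> policy) : \bar R :=
  limn_esup (fun N => team_cost (fun i : 'I_N => g i)).

Definition optimal_team_infty (U : set 'rV[R]_n) (g : nat -> policy) : Prop :=
  minimizes [set g' : nat -> policy | forall i, admissible U (g' i)]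
    team_cost_infty g.

End team.

(* Main.v *)
From HB Require Import structures.
Require Import Defs.
From mathcomp Require Import all_boot all_order all_algebra.
From mathcomp Require Import all_classical all_reals all_analysis.
From mathcomp Require Import measurable_realfun ring lra.
Import Order.TTheory GRing.Theory Num.Theory.
Import numFieldNormedType.Exports.
Local Open Scope classical_set_scope.
Local Open Scope ring_scope.

(** The idea is to compare, for each number [N] of decision makers, the costs of
the two identically symmetric policies [gamma N] and [gamma_infty].

If [g'] is any admissible family then, [gamma N] being optimal for the team of
size [N], its [N]-agent cost is at least that of [gamma N]; so
[J g' >= limsup_N J_N (gamma N)], and it suffices to show that
[J_N gamma_infty <= J_N (gamma N) + o(1)].

The cost [c (omega0 w)] is almost surely a finite convex function on the whole
space, hence Lipschitz on a ball of radius [B] containing [U].  Its Lipschitz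
constant [L w] can be chosen measurable in [w]: on the cube of half-width [2 B]
a convex function is at most the sum of its nonnegative values at the vertices
([convex_le_vertices2]), and a nonnegative convex function bounded by [M] on the
ball of radius [2 B] is [M / B]-Lipschitz on the ball of radius [B]
([convex_locally_lipschitz]).

Nothing makes [L] integrable, so it is truncated at a level [K].  Where
[L w <= K], changing the actions changes the mean cost by at most [2 K] times the
empirical mean of the changes; where [L w > K], the cost is bounded by the
dominating function [G].  Integrating ([expected_mean_cost_perturb]),
[J_N gamma_infty <= J_N (gamma N) + E[G; L > K] + 2 K delta_N],
where [delta_N] is the expected distance between the actions prescribed by
[gamma_infty] and [gamma N] to one decision maker.  Since [x] is independent of
the identically distributed [z i], the pairs [(x, z i)] all have the same law, so
[delta_N] does not depend on the decision maker
([expectation_independent_of_agent]).  By dominated convergence [delta_N] tends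
to 0 as [N] grows ([bounded_cvg_L1]) and [E[G; L > K]] tends to 0 as [K] grows
([tail_integral_cvg0]); choosing first [K] and then [N] concludes.

Convexity of [U] serves to keep the mean action in [U], where [G] dominates the
cost. *)

(** * Borel measurability of vector-valued functions *)

Section borel_measurability.
Context {d : measure_display} {T : measurableType d} {R : realType}.

Lemma measurable_fun_borel_comp (k : nat) 
    (f : T -> 'rV[R]_k) (F : 'rV[R]_k -> R) :
  measurable_fun setT (f : T -> borel R k) -> continuous F ->
  measurable_fun setT (F \o f).
Proof.
move=> mf cF; apply: (measurability _ (RGenOpens.measurableE R)).
move=> _ [_ [a [b ->]] <-]; rewrite setTI -[X in measurable X]setTI.
rewrite comp_preimage; apply: mf => //.
apply: sub_sigma_algebra => /=.
by move: cF => /continuousP; apply; exact: interval_open.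
Qed.

Lemma measurable_fun_coord (k : nat) (f : T -> 'rV[R]_k) (j : 'I_k) :
  measurable_fun setT (f : T -> borel R k) ->
  measurable_fun setT (fun w => f w ord0 j).
Proof.
move=> mf.
exact: (@measurable_fun_borel_comp k f (fun u => u ord0 j) mf
  (@coord_continuous R 1 k ord0 j)).
Qed.

(** Every open set of row vectors is a countable union of balls with rational
centre and radius [1 / N.+1]; for the max norm the preimage of such a ball is a
finite intersection of coordinate conditions. *)
Lemma measurable_fun_row (k : nat) (f : T -> 'rV[R]_k) :
  (forall j, measurable_fun setT (fun w => f w ord0 j)) ->
  measurable_fun setT (f : T -> borel R k).
Proof.
move=> mf; apply: (@measurability _ _ _ (borel R k) _ _ (@open 'rV[R]_k)) => //.
move=> _ [V oV <-]; rewrite setTI.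
pose I := ('rV[rat]_k * nat)%type.
(* [B] enumerates the balls of rational centre and radius [1 / N.+1]. *)
pose B (i : I) : set 'rV[R]_k := ball (map_mx ratr i.1 : 'rV[R]_k) i.2.+1%:R^-1.
have -> : V = \bigcup_(i in [set i | B i `<=` V]) B i.
  apply/seteqP; split => [u Vu|u [i iV] /iV] //.
  have /nbhs_ballP [e /= e0 eV] := open_nbhs_nbhs (conj oV Vu).
  have [N Ne] : exists N : nat, (N.+1%:R^-1 : R) < e / 2.
    have [|N] := @ltr_add_invr R 0 (e / 2); first by rewrite divr_gt0.
    by rewrite add0r => ?; exists N.
  have Npos : 0 < (N.+1%:R^-1 : R) by rewrite invr_gt0.
  have ltuN j : u ord0 j - N.+1%:R^-1 < u ord0 j + N.+1%:R^-1.
    by rewrite ltrBlDr -addrA ltrDl addr_gt0.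
  pose q : 'rV[rat]_k := \row_j projT1 (cid (rat_in_itvoo (ltuN j))).
  have quN : ball (map_mx ratr q : 'rV[R]_k) N.+1%:R^-1 u.
    split=> // i j; rewrite (ord1 i) !mxE; case: cid => r /=.
    rewrite in_itv/= => /andP[r1 r2]; rewrite /ball/= ltr_norml.
    by apply/andP; split; [rewrite ltrBrDl; exact: r1|rewrite ltrBlDl; exact: r2].
  exists (q, N) => //= y qy; apply: eV.
  apply: (@ball_splitr _ _ (map_mx ratr q : 'rV[R]_k)).
    by apply: le_ball quN; exact: ltW.
  by apply: le_ball qy; exact: ltW.
rewrite preimage_bigcup bigcup_mkcond.
apply: countable_bigcupT_measurable; first exact: countableP.
move=> i; case: ifP => // _.
have -> : f @^-1` B i = \bigcap_(j in [set: 'I_k])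
    ((fun w => f w ord0 j) @^-1` ball (ratr (i.1 ord0 j) : R) i.2.+1%:R^-1).
  apply/seteqP; split=> [w [_ wB] j _|w wB].
    by have := wB ord0 j; rewrite mxE.
  split => [|a j]; first by rewrite invr_gt0.
  by rewrite (ord1 a) mxE; exact: wB.
apply: fin_bigcap_measurable => // j _.
rewrite -[X in measurable X]setTI; apply: mf => //.
exact: measurable_ball.
Qed.

Lemma measurable_fun_row_cvg (k : nat) (g : nat -> T -> 'rV[R]_k)
    (f : T -> 'rV[R]_k) :
  (forall N, measurable_fun setT (g N : T -> borel R k)) ->
  (forall w, g N w @[N --> \oo] --> f w) ->
  measurable_fun setT (f : T -> borel R k).
Proof.
move=> mg gf; apply: measurable_fun_row => j.
apply: (@measurable_fun_cvg _ _ _ _ (fun N w => g N w ord0 j)) => [N|w _].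
  exact: measurable_fun_coord.
apply: (@cvg_comp _ _ _ (fun N => g N w) (fun u : 'rV[R]_k => u ord0 j) _ _ _
  (gf w)).
exact: coord_continuous.
Qed.

Lemma measurable_fun_row_sum (k : nat) (I : Type) (s : seq I)
    (f : I -> T -> 'rV[R]_k) :
  (forall i, measurable_fun setT (f i : T -> borel R k)) ->
  measurable_fun setT ((fun w => \sum_(i <- s) f i w) : T -> borel R k).
Proof.
move=> mf; apply: measurable_fun_row => j.
under eq_fun do rewrite summxE.
by apply: measurable_sum => i; exact: measurable_fun_coord.
Qed.

Lemma measurable_fun_row_scale (k : nat) (a : R) (f : T -> 'rV[R]_k) :
  measurable_fun setT (f : T -> borel R k) ->
  measurable_fun setT ((fun w => a *: f w) : T -> borel R k).
Proof.
move=> mf; apply: measurable_fun_row => j.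
under eq_fun do rewrite mxE.
by apply: measurable_funM => //; exact: measurable_fun_coord.
Qed.

Lemma measurable_fun_norm_sub (k : nat) (f g : T -> 'rV[R]_k) :
  measurable_fun setT (f : T -> borel R k) ->
  measurable_fun setT (g : T -> borel R k) ->
  measurable_fun setT (fun w => `|f w - g w|).
Proof.
move=> mf mg.
apply: (@measurable_fun_borel_comp k (fun w => f w - g w) (fun u => `|u|)).
  apply: measurable_fun_row => j; under eq_fun do rewrite !mxE.
  by apply: measurable_funB; exact: measurable_fun_coord.
exact: norm_continuous.
Qed.

End borel_measurability.

(** * Common law of the pairs (x, z i) *)

Section common_law.
Context {R : realType} {d dX dZ : measure_display} {T : measurableType d}.
Context {X : measurableType dX} {Z : measurableType dZ}.
Context (P : probability T R) (x : {mfun T >-> X}) (z : nat -> {mfun T >-> Z}).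
Hypothesis z_id : identically_distributed P (fun i => z i).
Hypothesis x_indep_z :
  independent_sigma P (sigma_of x) (sigma_of_seq (fun i => z i)).

Let mxz i : measurable_fun setT (fun w => (x w, z i w)).
Proof. exact: measurable_fun_pair. Qed.

Let xz i : {mfun T >-> (X * Z)%type} :=
  HB.pack (fun w => (x w, z i w)) (isMeasurableFun.Build _ _ _ _ _ (mxz i)).

Lemma joint_law_rectangle i (A : set X) (B : set Z) :
  measurable A -> measurable B ->
  P (xz i @^-1` (A `*` B)) = (P (x @^-1` A) * P (z i @^-1` B))%E.
Proof.
move=> mA mB; rewrite -x_indep_z //; first by exists A; rewrite ?setTI.
by apply: sub_sigma_algebra; exists i => //; exists B; rewrite ?setTI.
Qed.

(** On rectangles both laws are the product of the law of [x] and of the common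
law of the [z i]; rectangles generate the product sigma-algebra and are stable
under intersection. *)
Lemma joint_law_eq i j (C : set (X * Z)) : measurable C ->
  distribution P (xz i) C = distribution P (xz j) C.
Proof.
apply: (measure_unique [set A `*` B | A in measurable & B in measurable]
  (fun=> setT)).
- exact: measurable_prod_measurableType.
- move=> _ _ [A mA [B mB <-]] [A' mA' [B' mB' <-]].
  exists (A `&` A'); first exact: measurableI.
  by exists (B `&` B'); [exact: measurableI|rewrite setXI].
- by move=> _; exists setT => //; exists setT => //; rewrite setXTT.
- by rewrite bigcup_const.
- move=> _ [A mA [B mB <-]]; rewrite /= /distribution /pushforward.
  by rewrite !joint_law_rectangle// (z_id i j _ mB).
- by move=> _; rewrite (le_lt_trans (probability_le1 _ _)) ?ltry.
Qed.

(** This reduces the expectation of an average over the decision makers to that of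
a single one, whatever their number. *)
Lemma expectation_independent_of_agent i j (F : X * Z -> \bar R) :
  measurable_fun setT F -> (forall y, 0 <= F y)%E ->
  (\int[P]_w F (x w, z i w) = \int[P]_w F (x w, z j w))%E.
Proof.
move=> mF F0.
have pushE k : (\int[P]_w F (x w, z k w) = \int[distribution P (xz k)]_y F y)%E.
  by rewrite (ge0_integral_pushforward (mxz k)).
rewrite !pushE; apply: eq_measure_integral => C mC _; exact: joint_law_eq.
Qed.

End common_law.

(** * Quantitative continuity of convex functions *)

Section convex_bounds.
Context {R : realType}.

Lemma convex_functionP (V : lmodType R) (F : V -> R) :
  @convex_function R V setT F -> forall (t : R) (p q : V), 0 <= t <= 1 ->
  F (t *: p + (1 - t) *: q) <= t * F p + (1 - t) * F q.
Proof.
move=> cF t p q /andP[t0 t1].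
have := cF (Itv01 t0 t1) p q; rewrite !inE => /(_ Logic.I Logic.I).
by [].
Qed.

(** Extend the segment from [q] to [p] beyond [p] by a length [B], up to a point
[e] which is still in the ball of radius [2 B].  Then [p] is a convex combination
of [e] and [q] with a weight at most [`|p - q| / B] on [e]. *)
Lemma convex_locally_lipschitz (V : normedModType R) (F : V -> R) (B M : R) :
  @convex_function R V setT F -> 0 < B -> (forall p, 0 <= F p) ->
  (forall p, `|p| <= 2 * B -> F p <= M) ->
  forall p q, `|p| <= B -> `|q| <= B -> F p <= F q + M / B * `|p - q|.
Proof.
move=> cF B0 F0 FM p q pB qB.
have M0 : 0 <= M by apply: (le_trans (F0 0)); apply: FM; rewrite normr0; lra.
have [->|pq] := eqVneq p q; first by rewrite subrr normr0 mulr0 addr0.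
set r := `|p - q|.
have r0 : 0 < r by rewrite normr_gt0 subr_eq0.
have rB0 : 0 < r + B by rewrite addr_gt0.
pose e := p + (B / r) *: (p - q).
have eB : `|e| <= 2 * B.
  rewrite (le_trans (ler_normD _ _))// normrZ ger0_norm; last first.
    by rewrite divr_ge0 // ltW.
  by rewrite divfK ?(gt_eqF r0)//; lra.
pose t := r / (r + B).
have t01 : 0 <= t <= 1.
  by rewrite divr_ge0 ?(ltW r0) ?(ltW rB0)//= ler_pdivrMr// mul1r lerDl ltW.
have {1}-> : p = t *: e + (1 - t) *: q.
  rewrite /e scalerDr scalerA.
  have -> : t * (B / r) = 1 - t by rewrite /t; field; rewrite !gt_eqF.
  by rewrite -addrA -scalerDr subrK -scalerDl addrC subrK scale1r.
apply: (le_trans (convex_functionP _ _ cF t e q t01)).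
have tF : t * F e <= M / B * r.
  rewrite (@le_trans _ _ (t * M))//.
    by rewrite ler_wpM2l ?FM//; case/andP: t01.
  rewrite mulrC -mulrA ler_wpM2l// mulrC /t ler_wpM2l ?(ltW r0)//.
  by rewrite lef_pV2 ?posrE// lerDr ltW.
rewrite [leRHS]addrC; apply: lerD => //.
by rewrite ler_piMl//; case/andP: t01; lra.
Qed.

Definition cube_vertex (k : nat) (B : R) (s : {ffun 'I_k -> bool}) : 'rV[R]_k :=
  \row_j (if s j then B else - B).

Lemma row_norm_le (k : nat) (u : 'rV[R]_k) (B : R) (j : 'I_k) :
  `|u| <= B -> `|u ord0 j| <= B.
Proof.
apply: le_trans; rewrite [leRHS]/Num.norm /= mx_normrE.
by apply/bigmax_geP; right; exists (ord0, j).
Qed.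

(** Bounding by the sum over the vertices, rather than by the maximum, is harmless
for a nonnegative function and keeps the bound visibly measurable when the
function depends on a parameter. *)
Lemma convex_le_vertices (k : nat) (F : 'rV[R]_k -> R) (B : R) :
  @convex_function R 'rV[R]_k setT F -> 0 < B -> (forall p, 0 <= F p) ->
  forall p, `|p| <= B -> F p <= \sum_s F (cube_vertex k B s).
Proof.
move=> cF B0 F0 p pB.
(* Induction on a rank [r] from which all coordinates are extreme. *)
suff H r (q : 'rV[R]_k) : (forall j, `|q ord0 j| <= B) ->
    (forall j : 'I_k, (r <= j)%N -> `|q ord0 j| = B) ->
    F q <= \sum_s F (cube_vertex k B s).
  apply: (H k) => [j|j]; first exact: row_norm_le.
  by rewrite leqNgt ltn_ord.
elim: r q => [|r IH] q qB qr.
  have -> : q = cube_vertex k B [ffun j => 0 <= q ord0 j].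
    apply/rowP => j; rewrite mxE ffunE; have := qr j isT.
    case: ifP => [q0|/negbT]; first by rewrite ger0_norm.
    by rewrite -ltNge => /ltr0_norm -> <-; rewrite opprK.
  by rewrite (bigD1 [ffun j => 0 <= q ord0 j])//= lerDl sumr_ge0.
have [rk|kr] := ltnP r k; last first.
  apply: IH => // j rj.
  by have := leq_trans (leq_ltn_trans rj (ltn_ord j)) kr; rewrite ltnn.
pose j0 := Ordinal rk.
pose face a : 'rV[R]_k := \row_j (if j == j0 then a else q ord0 j).
(* [q] divides the segment joining the faces [j0 = B] and [j0 = - B] in the
   ratio for which [q ord0 j0 = t * B - (1 - t) * B]. *)
pose t := (1 + q ord0 j0 / B) / 2.
have qB01 : -1 <= q ord0 j0 / B <= 1.
  rewrite -ler_norml normrM normfV (gtr0_norm B0) ler_pdivrMr// mul1r.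
  exact: qB.
have t01 : 0 <= t <= 1 by rewrite /t; lra.
have -> : q = t *: face B + (1 - t) *: face (- B).
  apply/rowP => j; rewrite !mxE; case: eqP => [->|_]; last first.
    by rewrite -mulrDl addrC subrK mul1r.
  by rewrite /t; field; rewrite gt_eqF.
have faceM a : `|a| = B -> F (face a) <= \sum_s F (cube_vertex k B s).
  move=> aB; apply: IH => j; rewrite mxE.
    by case: eqP => _; rewrite ?aB.
  case: eqP => [_|/eqP jj0]; first by rewrite aB.
  move=> rj; apply: qr; rewrite ltn_neqAle rj andbT.
  by apply: contraNneq jj0 => rj'; apply/eqP/val_inj.
apply: (le_trans (convex_functionP _ _ cF t _ _ t01)).
have := faceM B (gtr0_norm B0); have := faceM (- B).
rewrite normrN (gtr0_norm B0) => /(_ erefl).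
move: (F _) (F _) (\sum_s _) t01 => a b S; nra.
Qed.

End convex_bounds.

(** A jointly convex function is convex in each argument, so
[convex_le_vertices] applies to the two arguments in turn. *)
Lemma convex_le_vertices2 (R : realType) (k l : nat)
    (F : 'rV[R]_k * 'rV[R]_l -> R) (B : R) :
  @convex_function R ('rV[R]_k * 'rV[R]_l)%type setT F -> 0 < B ->
  (forall p, 0 <= F p) -> forall p, `|p| <= B ->
  F p <= \sum_s \sum_t F (cube_vertex k B s, cube_vertex l B t).
Proof.
move=> cF B0 F0 [u a] uaB.
have [uB aB] : `|u| <= B /\ `|a| <= B.
  by move: uaB; rewrite prod_normE /= ge_max => /andP.
have slice1 b : @convex_function R 'rV[R]_k setT (fun v => F (v, b)).
  move=> t v w _ _; have := cF t (v, b) (w, b); rewrite !inE.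
  move=> /(_ Logic.I Logic.I); apply: le_trans; rewrite le_eqVlt; apply/orP; left.
  by apply/eqP; congr F; congr pair; rewrite /= -scalerDl addrC subrK scale1r.
have slice2 v : @convex_function R 'rV[R]_l setT (fun b => F (v, b)).
  move=> t b b' _ _; have := cF t (v, b) (v, b'); rewrite !inE.
  move=> /(_ Logic.I Logic.I); apply: le_trans; rewrite le_eqVlt; apply/orP; left.
  by apply/eqP; congr F; congr pair; rewrite /= -scalerDl addrC subrK scale1r.
apply: (le_trans
  (convex_le_vertices k (fun v => F (v, a)) B (slice1 a) B0 _ u uB)) => //.
apply: ler_sum => s _.
exact: (convex_le_vertices l (fun b => F (_, b)) B (slice2 _) B0).
Qed.

(** * Mean costs and mean actions *)

Section empirical_mean.
Context {R : realType}.

Definition mean (V : lmodType R) (N : nat) (u : 'I_N -> V) : V :=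
  N%:R^-1 *: \sum_(i < N) u i.

Lemma convex_set_mean (V : lmodType R) (U : set V) (N : nat) (u : 'I_N -> V) :
  @convex_set R V U -> (0 < N)%N -> (forall i, U (u i)) -> U (mean V N u).
Proof.
move=> cU; case: N u => // N u _; elim: N u => [|N IH] u Uu.
  by rewrite /mean big_ord1 invr1 scale1r.
pose t : R := N.+1%:R / N.+2%:R.
have t0 : 0 <= t by rewrite divr_ge0.
have t1 : t <= 1 by rewrite ler_pdivrMr// mul1r ler_nat.
have := cU (mean V N.+1 (fun i => u (widen_ord (leqnSn _) i))) (u ord_max)
  (Itv01 t0 t1).
rewrite !inE => /(_ (IH _ (fun i => Uu _)) (Uu _)).
congr (U _); rewrite /conv/= /mean [in RHS]big_ord_recr/= scalerDr.
rewrite [X in X + _]scalerA.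
congr (_ *: _ + _ *: _); rewrite /t.
  by field; rewrite -natrD nat1r !pnatr_eq0.
by rewrite /unstable.onem; field; rewrite -natrD pnatr_eq0.
Qed.

Lemma norm_mean_le (V : normedModType R) (N : nat) (u : 'I_N -> V) :
  `|mean V N u| <= N%:R^-1 * \sum_i `|u i|.
Proof.
rewrite /mean normrZ ger0_norm ?invr_ge0// ler_wpM2l ?invr_ge0//.
exact: ler_norm_sum.
Qed.

(** The comparison at a fixed outcome.  If [L <= K], the Lipschitz bound applies;
the factor 2 arises because an agent's cost sees both the change of the agent's
own action and the change of the mean action.  If [K < L], the left-hand side is
simply bounded by [G]. *)
Lemma mean_cost_perturb (V : normedModType R) (N : nat) (U : set V)
    (f : V * V -> R) (B L K G : R) (u u' : 'I_N -> V) :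
  @convex_set R V U -> (forall p, U p -> `|p| <= B) -> 0 <= K ->
  (forall p, 0 <= f p) ->
  (forall p q, `|p| <= B -> `|q| <= B -> f p <= f q + L * `|p - q|) ->
  (forall p q, U p -> U q -> f (p, q) <= G) ->
  (0 < N)%N -> (forall i, U (u i)) -> (forall i, U (u' i)) ->
  N%:R^-1 * (\sum_i f (u i, mean V N u)) <=
  N%:R^-1 * (\sum_i f (u' i, mean V N u')) + G * (K < L)%R%:R +
  2 * K * (N%:R^-1 * \sum_i `|u i - u' i|).
Proof.
move=> cU UB K0 f0 fL fG N0 Uu Uu'.
have N0' : 0 < N%:R :> R by rewrite ltr0n.
have Ni0 : 0 <= N%:R^-1 :> R by rewrite invr_ge0 ltW.
have meanC (a : R) : N%:R^-1 * (\sum_(i < N) a) = a.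
  by rewrite sumr_const card_ord -(mulr_natl a) mulKf// gt_eqF.
have D0 : 0 <= N%:R^-1 * \sum_i `|u i - u' i|.
  by rewrite mulr_ge0// sumr_ge0.
set D := _ * \sum_i `|_ - _| in D0 *.
have Um := convex_set_mean V U N u cU N0 Uu.
have Um' := convex_set_mean V U N u' cU N0 Uu'.
have S0 : 0 <= N%:R^-1 * (\sum_i f (u' i, mean V N u')).
  by rewrite mulr_ge0// sumr_ge0.
have [KL|LK] := ltrP K L; rewrite ?mulr1 ?mulr0 ?addr0.
  have : N%:R^-1 * (\sum_i f (u i, mean V N u)) <= G.
    rewrite -[leRHS]meanC ler_wpM2l// ler_sum// => i _; exact: fG.
  by move: S0 D0 K0; clear; move: (_ * _) (_ * _) => a b; nra.
have fi i : f (u i, mean V N u) <=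
    f (u' i, mean V N u') + K * (`|u i - u' i| + D).
  have pB (p q : V) : U p -> U q -> `|(p, q)| <= B.
    by move=> /UB pB /UB qB; rewrite prod_normE /= ge_max pB.
  apply: (le_trans (fL _ _ (pB _ _ (Uu i) Um) (pB _ _ (Uu' i) Um'))).
  rewrite lerD2l.
  apply: (@le_trans _ _ (K * `|(u i, mean V N u) - (u' i, mean V N u')|)).
    by rewrite ler_wpM2r.
  rewrite ler_wpM2l// prod_normE /= ge_max; apply/andP; split.
    by rewrite lerDl.
  have -> : mean V N u - mean V N u' = mean V N (fun i => u i - u' i).
    by rewrite /mean sumrB scalerBr.
  by rewrite (le_trans (norm_mean_le _ _ _))// lerDr.
have -> : 2 * K * D = N%:R^-1 * \sum_i K * (`|u i - u' i| + D).
  rewrite -mulr_sumr big_split/= [RHS]mulrCA [_^-1 * (_ + _)]mulrDr.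
  rewrite meanC -/D; ring.
by rewrite -mulrDr -big_split ler_wpM2l// ler_sum.
Qed.

End empirical_mean.

(** * Limits *)

Lemma limn_esup_le (R : realType) (a b : nat -> \bar R) :
  (forall e : R, 0 < e -> \forall N \near \oo, (a N <= b N + e%:E)%E) ->
  (limn_esup a <= limn_esup b)%E.
Proof.
move=> ab; apply/lee_addgt0Pr => e /ab [N0 _ abN].
rewrite -leeBlDr// /limn_esup /limf_esup.
apply: le_ereal_inf_tmp => _ [V FV <-].
rewrite leeBlDr//; apply: ge_ereal_inf.
exists (ereal_sup (a @` (V `&` [set N | (N0 <= N)%N]))).
  exists (V `&` [set N | (N0 <= N)%N]) => //.
  by apply: filterI => //; exists N0.
apply: ge_ereal_sup => _ [N [VN N0N] <-].
apply: (le_trans (abN _ N0N)); apply: leeD => //.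
by apply: ereal_sup_ubound; exists N.
Qed.

Section vanishing_errors.
Local Open Scope ereal_scope.
Context {R : realType} {d : measure_display} {T : measurableType d}.
Context (P : probability T R).

Lemma bounded_cvg_L1 (k : nat) (B : R) (u_ : nat -> T -> 'rV[R]_k)
    (u : T -> 'rV[R]_k) :
  (forall N, measurable_fun setT (u_ N : T -> borel R k)) ->
  measurable_fun setT (u : T -> borel R k) ->
  (forall N w, (`|u_ N w| <= B)%R) -> (forall w, (`|u w| <= B)%R) ->
  (forall w, u_ N w @[N --> \oo] --> u w) ->
  \int[P]_w (`|u w - u_ N w|%R)%:E @[N --> \oo] --> 0.
Proof.
move=> mu_ mu u_B uB uu.
have merr N : measurable_fun setT (fun w => (`|u w - u_ N w|%R)%:E).
  by apply/measurable_EFinP; exact: measurable_fun_norm_sub.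
have [| | |_ _] := @dominated_convergence _ _ _ P setT measurableT
  (fun N w => (`|u w - u_ N w|%R)%:E) (cst 0) (cst (2 * B)%:E)
  merr (measurable_cst _); last by rewrite integral0.
- apply: aeW => w _; apply/cvg_EFin; first exact: nearW.
  rewrite -(normr0 'rV[R]_k) -(subrr (u w)).
  by apply: cvg_norm; apply: cvgB => //; exact: cvg_cst.
- exact: finite_measure_integrable_cst.
- apply: aeW => w N _; rewrite /= normr_id lee_fin.
  by rewrite (le_trans (ler_normB _ _))// mulr_natl mulr2n lerD.
Qed.

Lemma measurable_fun_lt_indicator (k : R) (L : T -> R) :
  measurable_fun setT L ->
  measurable_fun setT (fun w => (k < L w)%R%:R : R).
Proof.
move=> mL.
rewrite (_ : (fun _ => _) = (fun w => if (k < L w)%R then 1%R else 0%R)).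
  by apply: measurable_fun_ifT => //; exact: measurable_fun_ltr.
by apply/funext => w; case: ifP.
Qed.

(** [L] is finite everywhere, so the truncated functions vanish eventually at each
point; [G] dominates them. *)
Lemma tail_integral_cvg0 (G L : T -> R) :
  P.-integrable setT (EFin \o G) -> measurable_fun setT L ->
  \int[P]_w (G w * (k%:R < L w)%R%:R)%:E @[k --> \oo] --> 0.
Proof.
move=> iG mL.
have mG : measurable_fun setT G.
  by apply/measurable_EFinP; exact: measurable_int iG.
have mtail k : measurable_fun setT (fun w => (G w * (k%:R < L w)%R%:R)%:E).
  apply/measurable_EFinP; apply: measurable_funM => //.
  exact: measurable_fun_lt_indicator.
have [| | |_ _] := @dominated_convergence _ _ _ P setT measurableT
  (fun k w => (G w * (k%:R < L w)%R%:R)%:E) (cst 0) (fun w => `|(G w)%:E|)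
  mtail (measurable_cst _); last by rewrite integral0.
- apply: aeW => w _; apply: cvg_near_cst.
  exists (Num.truncn (L w)).+1 => //= k /= Lk.
  rewrite ltNge (ltW (lt_le_trans (truncnS_gt _) _)) ?mulr0// ler_nat//.
- exact: integrable_abse.
- apply: aeW => w k _; rewrite lee_fin normrM.
  by rewrite ler_piMr// normr_nat; case: ltP.
Qed.

End vanishing_errors.

(** * Comparison of expected costs *)

Section cost_comparison.
Context {R : realType} {n : nat} {d d0 : measure_display} {T : measurableType d}.
Context (P : probability T R) {Omega0 : measurableType d0}.
Context (omega0 : {mfun T >-> Omega0}).
Context (c : Omega0 -> 'rV[R]_n -> 'rV[R]_n -> R).
Hypothesis c_ge0 : forall e u a, 0 <= c e u a.
Hypothesis c_meas : measurable_fun [set: Omega0 * (borel R n * borel R n)]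
  (fun p : Omega0 * (borel R n * borel R n) => c p.1 p.2.1 p.2.2).

Lemma measurable_cost (u a : T -> 'rV[R]_n) :
  measurable_fun setT (u : T -> borel R n) ->
  measurable_fun setT (a : T -> borel R n) ->
  measurable_fun setT (fun w => c (omega0 w) (u w) (a w)).
Proof.
move=> mu ma.
pose p (w : T) : Omega0 * (borel R n * borel R n) := (omega0 w, (u w, a w)).
apply: (@measurableT_comp _ _ _ _ _ _
  (fun p : Omega0 * (borel R n * borel R n) => c p.1 p.2.1 p.2.2) _ p) => //.
by apply: measurable_fun_pair => //; exact: measurable_fun_pair.
Qed.

Lemma measurable_mean (N : nat) (u : 'I_N -> T -> 'rV[R]_n) :
  (forall i, measurable_fun setT (u i : T -> borel R n)) ->
  measurable_fun setT ((fun w => mean _ N (u ^~ w)) : T -> borel R n).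
Proof.
move=> mu; apply: measurable_fun_row_scale.
exact: measurable_fun_row_sum.
Qed.

(** A Lipschitz constant of [c (omega0 w)] on the ball of radius [B]: the bound
[M / B] of [convex_locally_lipschitz], with [M] the vertex sum of
[convex_le_vertices2] on the cube of half-width [2 * B]. *)
Definition cost_lipschitz (B : R) (w : T) : R :=
  (\sum_s \sum_t
     c (omega0 w) (cube_vertex n (2 * B) s) (cube_vertex n (2 * B) t)) / B.

Lemma measurable_cost_lipschitz (B : R) :
  measurable_fun setT (cost_lipschitz B).
Proof.
apply: measurable_funM => //.
by do 2 (apply: measurable_sum => ?); exact: measurable_cost.
Qed.

Lemma cost_lipschitzP (B : R) (w : T) : 0 < B ->
  @convex_function R ('rV[R]_n * 'rV[R]_n)%type setT
    (fun p => c (omega0 w) p.1 p.2) ->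
  forall p q : 'rV[R]_n * 'rV[R]_n, `|p| <= B -> `|q| <= B ->
  c (omega0 w) p.1 p.2 <=
    c (omega0 w) q.1 q.2 + cost_lipschitz B w * `|p - q|.
Proof.
move=> B0 cw p q pB qB.
apply: (convex_locally_lipschitz _ (fun p => c (omega0 w) p.1 p.2)) => // r rB.
by apply: (convex_le_vertices2 R n n (fun p => c (omega0 w) p.1 p.2)) => //; lra.
Qed.

(** The team cost as a function of the random actions: [team_cost] is its
specialization to [u i w = g i (v i w)], by conversion. *)
Definition expected_mean_cost (N : nat) (u : 'I_N -> T -> 'rV[R]_n) : \bar R :=
  ((N%:R^-1)%:E *
   'E_P[fun w => (\sum_(i < N) c (omega0 w) (u i w) (mean _ N (u ^~ w)))%R])%E.

Context (U : set 'rV[R]_n) (B : R) (G : T -> R).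
Hypothesis c_convex : {ae P, forall w,
  @convex_function R ('rV[R]_n * 'rV[R]_n)%type setT
    (fun p : 'rV[R]_n * 'rV[R]_n => c (omega0 w) p.1 p.2)}.
Hypothesis c_dominated : {ae P, forall w, forall u a, U u -> U a ->
  c (omega0 w) u a <= G w}.
Hypothesis G_meas : measurable_fun setT G.
Hypothesis G_ge0 : forall w, 0 <= G w.
Hypothesis U_convex : @convex_set R 'rV[R]_n U.
Hypothesis B_gt0 : 0 < B.
Hypothesis U_bounded : forall u, U u -> `|u| <= B.

(** Integration of [mean_cost_perturb] with [L := cost_lipschitz B w].  The
expected distance [delta] is common to all agents, hence equal to the expectation
of its empirical mean. *)
Lemma expected_mean_cost_perturb (N : nat) (u u' : 'I_N -> T -> 'rV[R]_n)
    (K : R) (delta : \bar R) :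
  (0 < N)%N -> 0 <= K ->
  (forall i, measurable_fun setT (u i : T -> borel R n)) ->
  (forall i, measurable_fun setT (u' i : T -> borel R n)) ->
  (forall i w, U (u i w)) -> (forall i w, U (u' i w)) ->
  (forall i, \int[P]_w (`|u i w - u' i w|)%:E = delta)%E ->
  (expected_mean_cost N u <= expected_mean_cost N u' +
    \int[P]_w (G w * (K < cost_lipschitz B w)%R%:R)%:E + (2 * K)%:E * delta)%E.
Proof.
move=> N0 K0 mu mu' Uu Uu' du.
have N0' : 0 <= N%:R^-1 :> R by rewrite invr_ge0.
pose S (u : 'I_N -> T -> 'rV[R]_n) w :=
  \sum_(i < N) c (omega0 w) (u i w) (mean _ N (u ^~ w)).
have S0 v w : 0 <= S v w by exact: sumr_ge0.
have mS v : (forall i, measurable_fun setT (v i : T -> borel R n)) ->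
    measurable_fun setT (S v).
  move=> mv; apply: measurable_sum => i; apply: measurable_cost => //.
  exact: measurable_mean.
have costE v : (forall i, measurable_fun setT (v i : T -> borel R n)) ->
    expected_mean_cost N v = (\int[P]_w (N%:R^-1 * S v w)%:E)%E.
  move=> mv; rewrite /expected_mean_cost unlock -ge0_integralZl_EFin//.
  - by move=> w _; rewrite lee_fin S0.
  - by apply/measurable_EFinP; exact: mS.
pose D w := N%:R^-1 * \sum_i `|u i w - u' i w|.
have mdu i : measurable_fun setT (fun w => `|u i w - u' i w|).
  exact: measurable_fun_norm_sub.
have D0 w : 0 <= D w by rewrite mulr_ge0// sumr_ge0.
have mD : measurable_fun setT D.
  by apply: measurable_funM => //; exact: measurable_sum.
have intD : (\int[P]_w (D w)%:E = delta)%E.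
  under eq_integral do rewrite EFinM.
  rewrite ge0_integralZl_EFin//; last 2 first.
  - by move=> w _; rewrite lee_fin sumr_ge0.
  - by apply/measurable_EFinP; exact: measurable_sum.
  under eq_integral do rewrite -sumEFin.
  rewrite ge0_integral_sum//; last by move=> i; exact/measurable_EFinP.
  rewrite (eq_bigr (fun=> delta)); last by move=> i _; exact: du.
  have delta0 : (0 <= delta)%E.
    by rewrite -(du (Ordinal N0)); apply: integral_ge0 => w _; rewrite lee_fin.
  have -> : (\sum_(i < N) delta = N%:R%:E * delta)%E.
    clear -delta0; elim: N => [|N IH]; first by rewrite big_ord0 mul0e.
    by rewrite big_ord_recr/= IH -natr1 EFinD ge0_muleDl ?mul1e// lee_fin.
  by rewrite muleA -EFinM mulVf ?mul1e// pnatr_eq0 -lt0n.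
rewrite !costE//.
have mtail : measurable_fun setT (fun w => G w * (K < cost_lipschitz B w)%R%:R).
  apply: measurable_funM => //; apply: measurable_fun_lt_indicator.
  exact: measurable_cost_lipschitz.
have tail0 w : (0 <= (G w * (K < cost_lipschitz B w)%R%:R)%:E)%E.
  by rewrite lee_fin mulr_ge0.
have mNS v : (forall i, measurable_fun setT (v i : T -> borel R n)) ->
    measurable_fun setT (fun w => (N%:R^-1 * S v w)%:E).
  by move=> mv; apply/measurable_EFinP; apply: measurable_funM => //; exact: mS.
rewrite -intD -ge0_integralZl_EFin//; last 3 first.
- by move=> w _; rewrite lee_fin.
- exact/measurable_EFinP.
- by rewrite mulr_ge0.
have mKD : measurable_fun setT (fun w => ((2 * K)%:E * (D w)%:E)%E).
  under eq_fun do rewrite -EFinM.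
  by apply/measurable_EFinP; exact: measurable_funM.
have KD0 w : (0 <= (2 * K)%:E * (D w)%:E)%E.
  by rewrite -EFinM lee_fin; apply: mulr_ge0 => //; exact: mulr_ge0.
have NS0 v w : (0 <= (N%:R^-1 * S v w)%:E)%E by rewrite lee_fin; exact: mulr_ge0.
move/measurable_EFinP in mtail.
have sum0 w : (0 <= (N%:R^-1 * S u' w)%:E +
    (G w * (K < cost_lipschitz B w)%R%:R)%:E)%E by exact: adde_ge0.
have msum : measurable_fun setT (fun w => (N%:R^-1 * S u' w)%:E +
    (G w * (K < cost_lipschitz B w)%R%:R)%:E)%E.
  by apply: emeasurable_funD => //; exact: mNS.
rewrite -ge0_integralD//; last exact: mNS.
rewrite -ge0_integralD//.
apply: ae_ge0_le_integral => //.
- exact: mNS.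
- by move=> w _; exact: adde_ge0.
- exact: emeasurable_funD.
apply: filterS2 c_convex c_dominated => w cw Gw _.
rewrite -EFinM -!EFinD lee_fin.
apply: (mean_cost_perturb _ N U (fun p => c (omega0 w) p.1 p.2) B) => //.
exact: cost_lipschitzP.
Qed.

End cost_comparison.

(** * Optimality of the limit policy *)

Theorem proposition1 (R : realType) (n m : nat) (n_gt0 : (0 < n)%N)
  (m_gt0 : (0 < m)%N)
  (d d0 dX dZ : measure_display)
  (T : measurableType d) (P : probability T R)
  (Omega0 : measurableType d0) (X : measurableType dX) (Z : measurableType dZ)
  (omega0 : {mfun T >-> Omega0}) (x : {mfun T >-> X})
  (z : nat -> {mfun T >-> Z}) (h : X * Z -> 'rV[R]_m)
  (U : set 'rV[R]_n) (c : Omega0 -> 'rV[R]_n -> 'rV[R]_n -> R)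
  (gamma : nat -> policy R n m) (gamma_infty : policy R n m)
  (h_meas : measurable_fun [set: X * Z] (h : X * Z -> borel R m))
  (c_ge0 : forall e u a, 0 <= c e u a)
  (c_meas : measurable_fun [set: Omega0 * (borel R n * borel R n)]
     (fun p : Omega0 * (borel R n * borel R n) => c p.1 p.2.1 p.2.2))
  (c_convex : {ae P, forall w,
     @convex_function R ('rV[R]_n * 'rV[R]_n)%type setT
       (fun p : 'rV[R]_n * 'rV[R]_n => c (omega0 w) p.1 p.2)})
  (c_dominated : exists g : T -> \bar R, P.-integrable setT g /\
     {ae P, forall w, forall u a, U u -> U a ->
        ((c (omega0 w) u a)%:E <= g w)%E})
  (U_compact : compact U) (U_convex : @convex_set R 'rV[R]_n U)
  (z_iid : iid P (fun i => z i))
  (x_indep_z : independent_sigma P (sigma_of x) (sigma_of_seq (fun i => z i)))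
  (gamma_optimal : forall N, (0 < N)%N ->
     optimal_team P c omega0 (fun i w => h (x w, z i w)) U
       (fun _ : 'I_N => gamma N))
  (gamma_cvg : forall y, gamma N y @[N --> \oo] --> gamma_infty y) :
  optimal_team_infty P c omega0 (fun i w => h (x w, z i w)) U
    (fun _ : nat => gamma_infty).
Proof.
have [z_indep z_id] := z_iid.
have [g [ig c_le_g]] := c_dominated.
have gamma_adm N : (0 < N)%N -> admissible U (gamma N).
  by move=> N0; have [/(_ (Ordinal N0))] := gamma_optimal N N0.
have ginf_adm : admissible U gamma_infty.
  split.
    (* [gamma 0] is unconstrained, hence the shifts of the index. *)
    apply: (@measurable_fun_row_cvg _ (borel R m) R n
      (fun N => gamma N.+1)) => [N|y].
      by case: (gamma_adm N.+1 isT).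
    by move: (gamma_cvg y); rewrite -(cvg_shiftS (fun N => gamma N y)).
  move=> y; have Ucl : closed U.
    by apply: compact_closed => //; exact: norm_hausdorff.
  apply: (@closed_cvg _ _ _ _ (fun N => gamma N y) U Ucl _ _ (gamma_cvg y)).
  by exists 1%N => // N /= N0; case: (gamma_adm N N0).
have [B [B0 UB]] : exists B : R, 0 < B /\ forall u, U u -> `|u| <= B.
  have [M [_ MU]] := compact_bounded U_compact.
  exists (`|M| + 1); split; first by rewrite ltr_wpDl.
  by move=> u /MU; apply; rewrite (le_lt_trans (ler_norm M))// ltrDl.
(* A real-valued version of the dominating function, nonnegative everywhere. *)
pose G w := fine `|g w|%E.
have iG : P.-integrable setT (EFin \o G).
  apply: (le_integrable measurableT _ _ ig) => //.
    apply/measurable_EFinP; apply: measurableT_comp => //.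
    by apply: measurableT_comp => //; exact: measurable_int ig.
  move=> w _; rewrite /= /G.
  by case: (g w) => [r| |]; rewrite /= ?normr_id ?normr0 ?leey.
have mG : measurable_fun setT G.
  by apply/measurable_EFinP; exact: measurable_int iG.
have G0 w : 0 <= G w by rewrite fine_ge0.
have c_le_G : {ae P, forall w, forall u a, U u -> U a ->
    c (omega0 w) u a <= G w}.
  apply: filterS2 c_le_g (integrable_ae measurableT ig) => w cg gfin u a Uu Ua.
  rewrite -lee_fin fineK ?abse_fin_num ?gfin//.
  exact: le_trans (cg u a Uu Ua) (lee_abs _).
pose v i w := h (x w, z i w).
have mv (p : policy R n m) i : admissible U p ->
    measurable_fun setT ((fun w => p (v i w)) : T -> borel R n).
  move=> [mp _]; apply:
    (@measurableT_comp _ _ _ _ (borel R m) (borel R n) p _ (v i) mp).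
  apply: (@measurableT_comp _ _ _ _ _ (borel R m) h _ _ h_meas).
  exact: measurable_fun_pair.
pose delta N :=
  (\int[P]_w (`|gamma_infty (v 0%N w) - gamma N (v 0%N w)|)%:E)%E.
have delta0 : delta N @[N --> \oo] --> 0%E.
  rewrite -cvg_shiftS /=.
  apply: (bounded_cvg_L1 P n B (fun N w => gamma N.+1 (v 0%N w))).
  - by move=> N; exact/mv/gamma_adm.
  - exact: mv.
  - by move=> N w; apply: UB; case: (gamma_adm N.+1 isT).
  - by move=> w; apply: UB; case: ginf_adm.
  - by move=> w; rewrite (cvg_shiftS (fun N => gamma N (v 0%N w))).
have delta_eq N i : (0 < N)%N ->
    (\int[P]_w (`|gamma_infty (v i w) - gamma N (v i w)|)%:E = delta N)%E.
  move=> N0; apply: (expectation_independent_of_agent P x z z_id x_indep_z i 0%N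
    (fun y => (`|gamma_infty (h y) - gamma N (h y)|)%:E)) => //.
  apply/measurable_EFinP.
  have [mi _] := ginf_adm; have [mN _] := gamma_adm N N0.
  apply: (measurable_fun_norm_sub n (gamma_infty \o h) (gamma N \o h)).
    exact: (@measurableT_comp _ _ _ _ (borel R m) (borel R n) _ _ h).
  exact: (@measurableT_comp _ _ _ _ (borel R m) (borel R n) _ _ h).
pose L := cost_lipschitz omega0 c B.
have mL : measurable_fun setT L by exact: measurable_cost_lipschitz.
have tail0 := tail_integral_cvg0 P G L iG mL.
have key (e : R) : 0 < e -> \forall N \near \oo,
    (team_cost P c omega0 v (fun _ : 'I_N => gamma_infty) <=
     team_cost P c omega0 v (fun _ : 'I_N => gamma N) + e%:E)%E.
  move=> e0; have e20 : 0 < e / 2 by rewrite divr_gt0.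
  have small (f : nat -> \bar R) (r : R) : f k @[k --> \oo] --> 0%E -> 0 < r ->
      \forall k \near \oo, (f k <= r%:E)%E.
    move=> f0 r0; apply: (f0 [set y | (y <= r%:E)%E]).
    apply/nbhs_EFin; exists r => //= y.
    rewrite /ball_/= sub0r normrN lee_fin => /ltW; apply: le_trans.
    exact: ler_norm.
  (* The truncation level comes first: [N0] depends on it. *)
  have [k0 _ /(_ k0 (leqnn _)) /= tailk] := small _ _ tail0 e20.
  have K2 : 0 < 2 * k0%:R + 1 :> R by rewrite ltr_wpDl// mulr_ge0.
  have [N0 _ deltaN] := small _ _ delta0 (divr_gt0 e20 K2).
  exists (maxn N0 1) => // N /=; rewrite geq_max => /andP[N0N N1].
  have := @expected_mean_cost_perturb R n d d0 T P Omega0 omega0 c c_ge0 c_meas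
    U B G c_convex c_le_G mG G0 U_convex B0 UB N (fun i w => gamma_infty (v i w))
    (fun i w => gamma N (v i w)) k0%:R (delta N) N1 (ler0n _ _)
    (fun i => mv _ _ ginf_adm)
    (fun i => mv _ _ (gamma_adm N N1)) (fun i w => ginf_adm.2 _)
    (fun i w => (gamma_adm N N1).2 _) (fun i => delta_eq N i N1).
  move=> /le_trans; apply; rewrite -addeA leeD// (splitr e) EFinD leeD//.
  rewrite (@le_trans _ _ ((2 * k0%:R)%:E * (e / 2 / (2 * k0%:R + 1))%:E)%E)//.
    by rewrite lee_wpmul2l ?lee_fin ?mulr_ge0//; exact: deltaN.
  rewrite -EFinM lee_fin mulrA ler_pdivrMr// mulrC ler_wpM2l ?(ltW e20)//.
  by rewrite lerDl.
split=> /=; first by [].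
apply/eqP; rewrite eq_le; apply/andP; split; last first.
  by apply: ereal_inf_lbound; exists (fun=> gamma_infty).
apply: le_ereal_inf_tmp => _ [g' g'_adm <-].
apply: (@le_trans _ _ (limn_esup (fun N =>
  team_cost P c omega0 v (fun _ : 'I_N => gamma N)))).
  exact: limn_esup_le.
apply: limn_esup_le => e e0; exists 1%N => // N /= N0.
have [_ ->] := gamma_optimal N N0.
rewrite -[leLHS]adde0 leeD ?lee_fin ?(ltW e0)//.
by apply: ereal_inf_lbound; exists (fun i => g' i).
Qed.
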